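(* Let $n$ be a non-negative integer. The map $\psi$ is a bijection from the set of Motzkin $n$-paths to $S_{n+1}(132,2\hat 13)$.
   Context: $S_n$ is the set of permutations of $\{1,\dots,n\}$ in one-line notation. For a string $q$ of distinct numbers, $red(q)$ is obtained by replacing the $j$-th smallest element of $q$ by $j$. $\pi$ avoids $132$ if no $i_1<i_2<i_3$ satisfy $red(\pi_{i_1}\pi_{i_2}\pi_{i_3})=132$. $\pi$ avoids the hatted pattern $2\hat13$ if for every $j_1<j_2$ with $\pi_{j_1}<\pi_{j_2}$ there are $t_1<t_2<t_3$ with $\{j_1,j_2\}\subseteq\{t_1,t_2,t_3\}$ and $red(\pi_{t_1}\pi_{t_2}\pi_{t_3})=213$. $S_{n+1}(132,2\hat13)$ is the set of permutations in $S_{n+1}$ avoiding both. A Motzkin path on the line $y=h$ is a lattice path starting and ending at points on $y=h$, consisting of up-steps $(1,1)$, down-steps $(1,-1)$ and flat-steps $(1,0)$, and never running below $y=h$; it is a Motzkin $n$-path if it has $n$ steps. It is proper on $y=h$ if it has no flat-step lying on $y=h$. A path consisting of a single point (zero steps) is allowed and is proper. In this statement, a Motzkin $n$-path is a Motzkin $n$-path on $y=0$, drawn from $(1,0)$ to $(n+1,0)$. Definition of $\psi$. Let $M$ be a Motzkin $n$-path from $(1,0)$ to $(n+1,0)$. (i) For each integer $h\ge0$ not exceeding the height of $M$, consider all maximal contiguous parts of $M$ that are proper Motzkin paths on $y=h$ (possibly single points). (ii) For each such part, the abscissas of the lattice points in which it meets $y=h$, written in increasing order, form a block. (iii) Arrange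 all the blocks (over all $h$) in decreasing order of their first elements and concatenate them; the resulting permutation of $\{1,\dots,n+1\}$ is $\psi(M)$. *)

(* Defs.v *)
From mathcomp Require Import all_boot all_order all_algebra.
From mathcomp Require Import classical_sets functions.

Set Implicit Arguments.
Unset Strict Implicit.
Unset Printing Implicit Defensive.

Import Order.TTheory GRing.Theory Num.Theory.

Local Open Scope ring_scope.
Local Open Scope classical_set_scope.

(* Permutations of {1, ..., m} are words [w : seq nat] in one-line notation;   *)
(* positions in a word are counted from 0.                                     *)

(* Intended for words with distinct letters. *)
Definition red (q : seq nat) : seq nat :=
  [seq (index x (sort leq q)).+1 | x <- q].

Definition occurs_at (p w : seq nat) (t1 t2 t3 : nat) : bool :=
  [&& (t1 < t2)%N, (t2 < t3)%N, (t3 < size w)%N &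
      red [:: nth 0 w t1; nth 0 w t2; nth 0 w t3]%N == p].

Definition avoids_132 (w : seq nat) : Prop :=
  ~ exists i1 i2 i3, occurs_at [:: 1; 3; 2]%N w i1 i2 i3.

Definition avoids_2hat13 (w : seq nat) : Prop :=
  forall j1 j2 : nat, (j1 < j2)%N -> (j2 < size w)%N ->
    (nth 0 w j1 < nth 0 w j2)%N ->
    exists t1 t2 t3, occurs_at [:: 2; 1; 3]%N w t1 t2 t3 /\
                     {subset [:: j1; j2] <= [:: t1; t2; t3]}.

Definition S_avoiding (m : nat) : set (seq nat) :=
  [set w | [/\ perm_eq w (iota 1 m), avoids_132 w & avoids_2hat13 w]].

Inductive step := Up | Down | Flat.

Definition rise (s : step) : int :=
  match s with Up => 1 | Down => -1 | Flat => 0 end.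

Definition is_flat (s : step) : bool := if s is Flat then true else false.

(* Ordinate reached after the first [k] steps of [p], starting at ordinate [y]. *)
Definition ordinate (y : int) (p : seq step) (k : nat) : int :=
  y + \sum_(s <- take k p) rise s.

(* A lattice path is given by the ordinate [y] of its first point and its list
   of steps [p]; abscissas play no role in the next two notions. *)
Definition motzkin_on (h y : int) (p : seq step) : bool :=
  [&& y == h, ordinate y p (size p) == h &
      all (fun k => h <= ordinate y p k) (iota 0 (size p).+1)].

Definition proper_on (h y : int) (p : seq step) : bool :=
  motzkin_on h y p &&
  all (fun k => ~~ (is_flat (nth Flat p k) && (ordinate y p k == h)))
      (iota 0 (size p)).

Definition motzkin_paths (n : nat) : set (seq step) :=
  [set M | size M = n /\ motzkin_on 0 0 M].

(* From here on the path [M] is drawn from (1, 0), so that its lattice points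
   have abscissas 1, ..., (size M).+1. *)
Definition height_at (M : seq step) (x : nat) : int := ordinate 0 M x.-1.

Definition abscissas (M : seq step) : seq nat := iota 1 (size M).+1.

(* [absz] loses nothing: a Motzkin path has nonnegative ordinates. *)
Definition height (M : seq step) : nat :=
  \max_(x <- abscissas M) `|height_at M x|%N.

(* The steps of the part of [M] between the abscissas [a] and [b]. *)
Definition part (M : seq step) (a b : nat) : seq step :=
  take (b - a) (drop a.-1 M).

Definition proper_part (M : seq step) (h : int) (ab : nat * nat) : bool :=
  [&& ab.1 \in abscissas M, ab.2 \in abscissas M, (ab.1 <= ab.2)%N &
      proper_on h (height_at M ab.1) (part M ab.1 ab.2)].

Definition subpart (ab cd : nat * nat) : bool :=
  (cd.1 <= ab.1)%N && (ab.2 <= cd.2)%N.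

Definition intervals (M : seq step) : seq (nat * nat) :=
  [seq (a, b) | a <- abscissas M, b <- abscissas M].

Definition maximal_proper_part (M : seq step) (h : int) (ab : nat * nat) : bool :=
  proper_part M h ab &&
  all (fun cd => proper_part M h cd && subpart ab cd ==> (cd == ab))
      (intervals M).

Definition block (M : seq step) (h : int) (ab : nat * nat) : seq nat :=
  [seq x <- iota ab.1 (ab.2 - ab.1).+1 | height_at M x == h].

Definition blocks (M : seq step) : seq (seq nat) :=
  flatten [seq [seq block M h%:Z ab
               | ab <- [seq ab <- intervals M | maximal_proper_part M h%:Z ab]]
          | h <- iota 0 (height M).+1].

Definition psi (M : seq step) : seq nat :=
  flatten (sort (fun s t => head 0%N t <= head 0%N s)%N (blocks M)).

(* Main.v *)
Require Import Defs.
From mathcomp Require Import all_boot all_order all_algebra zify.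
From mathcomp Require Import classical_sets functions.

Set Implicit Arguments.
Unset Strict Implicit.
Unset Printing Implicit Defensive.

Import Order.TTheory GRing.Theory Num.Theory.

(** A Motzkin path is empty, or F M, or U M1 D M2. Let the permutations attached
to M1, M2 be p1 (of length s) and u 1 v, and let +k denote adding k to all the
entries. The blocks of U M1 D M2 are those of M1 and M2, shifted, except that the
abscissa 1 joins the block of the first point of M2; hence psi (F M) is
(psi M + 1) 1, and psi (U M1 D M2) is (u + k) (p1 + 1) 1 (1 + k) (v + k) with
k = s + 1.

On the other side, take a permutation avoiding both patterns in which 1 is not
the last entry, and let b be the entry following 1. Avoidance of 132 makes every
entry after b exceed b, and puts the entries larger than b before those smaller
than b to the left of 1. The hatted pattern, applied to the ascent 1 b, provides
an entry strictly between 1 and b. So the permutation has the form displayed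
above with s = b - 2 > 0, and it avoids both patterns iff p1 and u 1 v do. *)

(** * Blocks *)

(** A strictly increasing list is determined by its set of elements. This compares blocks that are
    cut out of different ranges of abscissas. *)
Lemma filter_sorted_ext (s1 s2 : seq nat) (P1 P2 : pred nat) :
  sorted ltn s1 -> sorted ltn s2 ->
  (forall x, (x \in s1) && P1 x = (x \in s2) && P2 x) ->
  filter P1 s1 = filter P2 s2.
Proof.
move=> so1 so2 eq12.
apply: (@irr_sorted_eq _ ltn ltn_trans ltnn); rewrite ?sorted_filter //.
- exact: ltn_trans.
- exact: ltn_trans.
- by move=> x; rewrite !mem_filter ![_ && (x \in _)]andbC eq12.
Qed.

(* Proper parts, seen through the ordinates only: a step is flat iff it joins two
   points of equal ordinate. *)
Definition link (H : nat -> int) (x y : nat) : bool :=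
  [&& (x <= y)%N, H x == H y,
      all (fun z => (H x <= H z)%R) (iota x (y - x).+1) &
      all (fun z => ~~ ((H z == H x) && (H z.+1 == H x))) (iota x (y - x))].

Lemma linkP (H : nat -> int) (x y : nat) :
  reflect [/\ x <= y, H x = H y,
              forall z, x <= z <= y -> (H x <= H z)%R &
              forall z, x <= z < y -> H z = H x -> H z.+1 <> H x]
          (link H x y).
Proof.
apply: (iffP and4P).
- case=> lexy /eqP eqH /allP ge /allP nf; split=> //.
  + by move=> z zxy; apply: ge; rewrite mem_iota; lia.
  + move=> z zxy e1 e2; have := nf z; rewrite mem_iota e1 e2 !eqxx => /(_ _).
    by move/implyP => /=; rewrite implybF; lia.
- case=> lexy eqH ge nf; split=> //; first exact/eqP.
  + by apply/allP=> z; rewrite mem_iota => hz; apply: ge; lia.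
  + apply/allP=> z; rewrite mem_iota => hz.
    by apply/negP=> /andP[/eqP e1 /eqP]; apply: nf => //; lia.
Qed.

Lemma link_gt H x y : y < x -> link H x y = false.
Proof. by rewrite ltnNge => /negbTE yx; rewrite /link yx. Qed.

Lemma link_refl H x : link H x x.
Proof. by apply/linkP; split=> // z; [move=> ?; have -> : z = x by lia | lia]. Qed.

Lemma link_trans H x y z : link H x y -> link H y z -> link H x z.
Proof.
move=> /linkP[xy exy gxy nxy] /linkP[yz eyz gyz nyz]; apply/linkP; split.
- exact: leq_trans yz.
- by rewrite exy.
- by move=> t ht; case: (leqP t y) => ?; [apply: gxy | rewrite exy; apply: gyz]; lia.
- move=> t ht; case: (ltnP t y) => ?; first by apply: nxy; lia.
  by rewrite exy; apply: nyz; lia.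
Qed.

Lemma link_prefix H x y z :
  link H x z -> x <= y <= z -> H y = H x -> link H x y.
Proof.
move=> /linkP[xz exz gxz nxz] xyz eyx; apply/linkP; split=> //; first by lia.
- by move=> t ht; apply: gxz; lia.
- by move=> t ht; apply: nxz; lia.
Qed.

Lemma link_suffix H x y z :
  link H x z -> x <= y <= z -> H y = H x -> link H y z.
Proof.
move=> /linkP[xz exz gxz nxz] xyz eyx; apply/linkP; split.
- by lia.
- by rewrite eyx.
- by move=> t ht; rewrite eyx; apply: gxz; lia.
- by move=> t ht; rewrite eyx; apply: nxz; lia.
Qed.

(** The relation only compares ordinates with each other, so translating the graph by [k]
    horizontally and by [c] vertically preserves it. Agreement is required only between [x] and [y],
    since nothing outside is inspected. *)
Lemma link_shift H H' (c : int) k x y :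
  (forall z, x <= z <= y -> H' (k + z) = (c + H z)%R) ->
  link H' (k + x) (k + y) = link H x y.
Proof.
move=> eH; rewrite /link leq_add2l subnDl.
case: (leqP x y) => [xy|//]; rewrite !andTb.
rewrite !eH ?leqnn ?xy // (inj_eq (addrI c)).
rewrite !iotaDl !all_map; congr [&& _, _ & _]; apply: eq_in_all => z;
  rewrite mem_iota => hz; rewrite /preim /=.
- by rewrite eH ?lerD2l //; lia.
- by rewrite -addnS !eH ?(inj_eq (addrI c)) //; lia.
Qed.

Lemma height_at1 M : height_at M 1 = 0%R.
Proof. by rewrite /height_at /ordinate /= take0 big_nil addr0. Qed.

Lemma height_atS M x : x < size M ->
  height_at M x.+2 = (height_at M x.+1 + rise (nth Flat M x))%R.
Proof.
move=> hx; rewrite /height_at /ordinate /= !add0r.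
by rewrite (take_nth Flat hx) -cats1 big_cat big_seq1.
Qed.

Lemma is_flat_nth M x : x < size M ->
  is_flat (nth Flat M x) = (height_at M x.+2 == height_at M x.+1).
Proof.
move=> hx; rewrite height_atS // -subr_eq0 addrAC subrr add0r.
by case: (nth _ _ _).
Qed.

Lemma ordinate_part M a b k : 0 < a -> a <= b -> k <= b - a ->
  ordinate (height_at M a) (part M a b) k = height_at M (a + k).
Proof.
case: a => // a _ ab kb; rewrite /height_at /ordinate /part /= !add0r.
by rewrite take_takel // takeD big_cat.
Qed.

Lemma mem_abscissas M x : (x \in abscissas M) = (0 < x <= (size M).+1).
Proof. by rewrite mem_iota; lia. Qed.

Lemma proper_partE M h a b :
  proper_part M h (a, b) =
  [&& a \in abscissas M, b \in abscissas M, height_at M a == h &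
      link (height_at M) a b].
Proof.
rewrite /proper_part /=; case Ea: (a \in _) => //=; case Eb: (b \in _) => //=.
move: Ea Eb; rewrite !mem_abscissas => Ea Eb.
rewrite /proper_on /motzkin_on /link.
case ab: (a <= b); last by rewrite /= andbF.
have sp : size (part M a b) = b - a.
  by rewrite /part size_takel // size_drop; lia.
case: eqP => [<-|//]; rewrite !andTb.
rewrite sp ordinate_part ?leqnn ?subnKC //; try lia.
have shift n : iota a n = [seq a + k | k <- iota 0 n].
  by rewrite -iotaDl addn0.
rewrite eq_sym -andbA; congr [&& _, _ & _].
- rewrite shift all_map.
  apply: eq_in_all => k; rewrite mem_iota => hk /=.
  by rewrite ordinate_part //; lia.
- rewrite shift all_map.
  apply: eq_in_all => k; rewrite mem_iota => hk /=; congr (~~ _).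
  rewrite ordinate_part; try lia.
  rewrite /part nth_take; last lia.
  rewrite nth_drop is_flat_nth; last lia.
  have -> : (a.-1 + k).+2 = (a + k).+1 by lia.
  have -> : (a.-1 + k).+1 = (a + k) by lia.
  by rewrite andbC; case: (height_at M (a + k) =P _) => //= ->.
Qed.

(** No right end is mentioned: when [a] is the left end of a maximal part, the points linked to [a]
    are exactly those of its block, so a block is determined by its first element. *)
Definition block_from (M : seq step) (a : nat) : seq nat :=
  [seq y <- abscissas M | link (height_at M) a y].

Definition starts_block (M : seq step) (a : nat) : bool :=
  all (fun c => link (height_at M) c a ==> (c == a)) (abscissas M).

Lemma maximalP M h a b :
  reflect [/\ [&& a \in abscissas M, b \in abscissas M & link (height_at M) a b],
              height_at M a = h &
              forall c d, c \in abscissas M -> d \in abscissas M ->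
                link (height_at M) c d -> height_at M c = h ->
                c <= a -> b <= d -> (c, d) = (a, b)]
          (maximal_proper_part M h (a, b)).
Proof.
rewrite /maximal_proper_part proper_partE.
apply: (iffP andP) => [[/and4P[Ea Eb /eqP Eh L] /allP mx]|[/and3P[Ea Eb L] Eh mx]].
- split=> //; first by rewrite Ea Eb.
  move=> c d Ec Ed Lcd Ehc ca bd; apply/eqP.
  have /mx : (c, d) \in intervals M by apply/allpairsP; exists (c, d).
  by rewrite proper_partE Ec Ed Lcd Ehc eqxx /subpart /= ca bd.
- rewrite Ea Eb Eh eqxx L; split=> //; apply/allP=> -[c d].
  case/allpairsP=> -[c' d'] /= [Ec Ed [-> ->]]; apply/implyP.
  rewrite proper_partE => /andP[/and4P[_ _ /eqP Ehc Lcd] /andP[ca bd]].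
  by apply/eqP; apply: mx.
Qed.

(** Cutting the part at a point on its base line leaves a proper part starting at [a]; conversely, a
    point linked to [a] beyond [b] would give a longer proper part. *)
Lemma block_maximal M h a b : maximal_proper_part M h (a, b) ->
  block M h (a, b) = block_from M a.
Proof.
case/maximalP=> /and3P[Ea Eb L] Eh mx.
move: Ea Eb; rewrite !mem_abscissas => Ea Eb.
have /linkP[ab _ _ _] := L.
apply: filter_sorted_ext; try exact: iota_ltn_sorted.
move=> z; rewrite !mem_iota [(a, b).1]/= [(a, b).2]/=; apply/andP/andP=> -[hz].
- move=> /eqP ez; split; first by lia.
  by apply: link_prefix L _ _; [lia | rewrite ez].
- move=> Lz; have /linkP[az e _ _] := Lz; split; last by rewrite -e Eh.
  have [|zb] := leqP z b; first by lia.
  have : (a, z) = (a, b) by apply: mx; rewrite ?mem_abscissas //; lia.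
  by case=> ezb; move: zb; rewrite ezb ltnn.
Qed.

Lemma head_block_from M a : a \in abscissas M -> head 0 (block_from M a) = a.
Proof.
rewrite /block_from mem_abscissas => Ea.
have -> : abscissas M = iota 1 a.-1 ++ a :: iota a.+1 ((size M).+1 - a).
  rewrite /abscissas; have -> : (size M).+1 = a.-1 + ((size M).+1 - a).+1 by lia.
  by rewrite iotaD /= add1n prednK //; [congr (_ ++ _ :: iota _ _) | ]; lia.
rewrite filter_cat /= link_refl.
rewrite (@eq_in_filter _ _ pred0) ?filter_pred0 // => z; rewrite mem_iota => hz.
by apply/negbTE/negP=> /linkP[]; lia.
Qed.

Lemma maximal_starts M h a b : maximal_proper_part M h (a, b) -> starts_block M a.
Proof.
case/maximalP=> /and3P[Ea Eb L] Eh mx; apply/allP=> c Ec; apply/implyP=> Lc.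
have Lcb := link_trans Lc L; have /linkP[ca e _ _] := Lc.
by have [-> //] : (c, b) = (a, b) by apply: mx; rewrite ?e.
Qed.

(** The right end is the farthest abscissa linked to [a]. *)
Lemma starts_maximal M a : a \in abscissas M -> starts_block M a ->
  exists b, maximal_proper_part M (height_at M a) (a, b).
Proof.
move=> Ea /allP st.
pose P b := (b \in abscissas M) && link (height_at M) a b.
have exP : exists b, P b by exists a; rewrite /P Ea link_refl.
have ubP b : P b -> b <= (size M).+1 by case/andP; rewrite mem_abscissas; lia.
have [b /andP[Eb L] mx] := ex_maxnP exP ubP.
exists b; apply/maximalP; split=> //; first by rewrite Ea Eb.
move=> c d Ec Ed Lcd e ca bd; have /linkP[ab _ _ _] := L.
(* A larger part also passes through [a] on its base line; cut there, it links [c] to [a], and no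
   other point is linked to a starting point from the left. *)
have eca : c = a.
  apply/eqP; have /implyP := st c Ec; apply.
  by apply: link_prefix Lcd _ _; rewrite ?ca ?e //=; lia.
rewrite eca; congr (_, _); apply/eqP; rewrite eqn_leq bd andbT.
by apply: mx; rewrite /P Ed -eca.
Qed.

Lemma mem_blocks M : (forall x, 0 <= height_at M x)%R ->
  blocks M =i [seq block_from M a | a <- rev (iota 1 (size M).+1) & starts_block M a].
Proof.
move=> ge0 s; apply/flatten_mapP/mapP.
- case=> h hh /mapP[[a b]]; rewrite mem_filter => /andP[mx _] ->.
  exists a; last exact: block_maximal mx.
  rewrite mem_filter mem_rev (maximal_starts mx).
  by have /maximalP[/and3P[]] := mx.
(* The level of the block is the ordinate of its first point, a natural number by nonnegativity and
   at most the height of the path. *)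
- case=> a; rewrite mem_filter mem_rev => /andP[st Ea] ->.
  have [b mx] := starts_maximal Ea st; have := ge0 a.
  case Eh: (height_at M a) mx => [h|//] mx _.
  exists h.
    rewrite mem_iota /= add0n ltnS.
    have -> : h = `|height_at M a|%N by rewrite Eh.
    exact: (leq_bigmax_seq (F := fun x => `|height_at M x|%N)).
  apply/mapP; exists (a, b); last by rewrite (block_maximal mx).
  rewrite mem_filter mx; apply/allpairsP; exists (a, b).
  by have /maximalP[/and3P[]] := mx.
Qed.

(** The first element of a block gives the left end of the part, its ordinate gives the level, and
    maximality then gives the right end; hence no block is listed twice. *)
Lemma uniq_blocks M : uniq (blocks M).
Proof.
apply: allpairs_uniq_dep; first exact: iota_uniq.
  move=> h _; apply: filter_uniq; apply: allpairs_uniq; try exact: iota_uniq.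
  by case=> [? ?] [].
move=> _ _ /allpairsPdep[h [[a b] [_ mx ->]]] /allpairsPdep[k [[c d] [_ nx ->]]] /=.
move: mx nx; rewrite !mem_filter => /andP[mx _] /andP[nx _].
rewrite (block_maximal mx) (block_maximal nx) => e.
have [/and3P[Ea Eb L] Eh mxx] := maximalP _ _ _ _ mx.
have [/and3P[Ec Ed N] Ek nxx] := maximalP _ _ _ _ nx.
have eac : a = c by rewrite -(head_block_from Ea) e head_block_from.
have [ehk] : h%:Z%R = k%:Z%R by rewrite -Eh -Ek eac.
rewrite -{}eac -{}ehk {nx} in Ec N Ek nxx *.
suff -> : b = d by [].
have [bd|/ltnW db] := leqP b d.
- by have [->] : (a, d) = (a, b) by apply: mxx.
- by have [->] : (a, b) = (a, d) by apply: nxx.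
Qed.

(** Both lists contain the same blocks once each, and both are sorted by first element. This order
    is antisymmetric on blocks because the first element determines the block, so the two sorted
    lists coincide. *)
Lemma psiE M : (forall x, 0 <= height_at M x)%R ->
  psi M = flatten [seq block_from M a | a <- rev (iota 1 (size M).+1) & starts_block M a].
Proof.
move=> ge0; rewrite /psi; congr flatten.
set leT := (fun s t => _); set bs := RHS.
have memP s : s \in bs -> exists2 a, a \in abscissas M & s = block_from M a.
  case/mapP=> a; rewrite mem_filter mem_rev => /andP[_ Ea] ->; by exists a.
have trT : transitive leT by move=> s t u; rewrite /leT; lia.
have anti : {in bs &, antisymmetric leT}.
  move=> s t /memP[a Ea ->] /memP[c Ec ->]; rewrite /leT !head_block_from //.
  by rewrite -eqn_leq => /eqP ->.
have gtn_sorted : sorted gtn [seq a <- rev (iota 1 (size M).+1) | starts_block M a].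
  apply: sorted_filter; first by move=> x y z /=; lia.
  by rewrite rev_sorted; exact: iota_ltn_sorted.
have uniq_bs : uniq bs.
  rewrite map_inj_in_uniq; first by rewrite filter_uniq // rev_uniq iota_uniq.
  move=> a c; rewrite !mem_filter !mem_rev => /andP[_ Ea] /andP[_ Ec] e.
  by rewrite -(head_block_from Ea) e head_block_from.
have pe : perm_eq (blocks M) bs.
  by apply: uniq_perm; [exact: uniq_blocks | | exact: mem_blocks].
have mem_sorted s : (s \in sort leT (blocks M)) = (s \in bs).
  by rewrite mem_sort (perm_mem pe).
apply: (@sorted_eq_in _ leT).
- by move=> s t u _ _ _; apply: trT.
- by move=> s t; rewrite !mem_sorted; apply: anti.
- by apply: sort_sorted => s t; rewrite /leT leq_total.
- rewrite sorted_map; apply: (sub_in_sorted (P := mem (abscissas M))) gtn_sorted.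
  + by move=> a c Ea Ec; rewrite /relpre /leT /= !head_block_from //; lia.
  + by apply/allP=> a; rewrite mem_filter mem_rev => /andP[].
- by rewrite perm_sort.
Qed.

(** * Decomposition of paths *)

Inductive tree := Leaf | FlatNode of tree | ArchNode of tree & tree.

Fixpoint word (t : tree) : seq step :=
  match t with
  | Leaf => [::]
  | FlatNode t' => Flat :: word t'
  | ArchNode t1 t2 => Up :: word t1 ++ Down :: word t2
  end.

Definition around_one (uv : seq nat * seq nat) : seq nat := uv.1 ++ 1 :: uv.2.

(* The entries of the permutation to the left and to the right of 1. *)
Fixpoint sides (t : tree) : seq nat * seq nat :=
  match t with
  | Leaf => ([::], [::])
  | FlatNode t' => (map (addn 1) (around_one (sides t')), [::])
  | ArchNode t1 t2 =>
      let p1 := around_one (sides t1) in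
      let k := (size p1).+1 in
      (map (addn k) (sides t2).1 ++ map (addn 1) p1,
       map (addn k) (1 :: (sides t2).2))
  end.

Definition perm_of (t : tree) : seq nat := around_one (sides t).

Lemma size_perm_of t : size (perm_of t) = (size (word t)).+1.
Proof.
elim: t => [|t IH|t1 IH1 t2 IH2] //.
- move: IH; rewrite /perm_of /around_one /= !(size_cat, size_map) /=.
  by rewrite ?(size_cat, size_map) /=; lia.
- move: IH1 IH2; rewrite /perm_of /around_one /= !(size_cat, size_map) /=.
  by rewrite ?(size_cat, size_map) /= ?size_map; lia.
Qed.

Lemma height_at0 M : height_at M 0 = 0%R.
Proof. exact: height_at1. Qed.

Lemma height_at_flat M z : 0 < z -> height_at (Flat :: M) (1 + z) = height_at M z.
Proof. by case: z => // z _; rewrite /height_at /ordinate /= big_cons !add0r. Qed.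

Lemma height_at_arch1 M1 M2 z : 0 < z <= (size M1).+1 ->
  height_at (Up :: M1 ++ Down :: M2) (1 + z) = (1 + height_at M1 z)%R.
Proof.
case: z => // z hz; rewrite /height_at /ordinate /= big_cons !add0r.
by rewrite takel_cat.
Qed.

Lemma height_at_arch2 M1 M2 z : 0 < z -> height_at M1 (size M1).+1 = 0%R ->
  height_at (Up :: M1 ++ Down :: M2) ((size M1).+2 + z) = height_at M2 z.
Proof.
case: z => // z _; rewrite /height_at /ordinate /= take_size !add0r => e.
rewrite big_cons takeD take_size_cat // drop_size_cat // take_cons.
by rewrite big_cat big_cons /= e add0r addrA subrr add0r.
Qed.

(** Nonnegativity can be claimed for every [x]: abscissa 0 is treated as abscissa 1 by the truncated
    predecessor, and past the end [take] returns the whole path, so the final ordinate is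
    repeated. *)
Lemma word_height t :
  height_at (word t) (size (word t)).+1 = 0%R /\
  forall x, (0 <= height_at (word t) x)%R.
Proof.
elim: t => [|t [IHe IH]|t1 [IHe1 IH1] t2 [IHe2 IH2]].
- by split=> [|x]; rewrite /height_at /ordinate /= big_nil.
- split=> [|[|[|x]]]; rewrite /= ?height_at0 ?height_at1 -?[_.+2]add1n ?height_at_flat //.
- split=> /=; rewrite ?size_cat /=.
    exact: etrans (height_at_arch2 _ _ IHe1) IHe2.
  case=> [|[|x]]; rewrite ?height_at0 ?height_at1 //.
  have [hx|hx] := leqP x (size (word t1)).
    by rewrite -[x.+2]add1n height_at_arch1 //; have := IH1 x.+1; lia.
  have -> : x.+2 = (size (word t1)).+2 + (x - size (word t1)) by lia.
  by rewrite height_at_arch2 //; lia.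
Qed.

(** * Reading the blocks of a path segment by segment *)

Definition read_blocks (M : seq step) (l : seq nat) : seq nat :=
  flatten [seq block_from M a | a <- rev l & starts_block M a].

Lemma read_blocks_cat M l1 l2 :
  read_blocks M (l1 ++ l2) = read_blocks M l2 ++ read_blocks M l1.
Proof. by rewrite /read_blocks rev_cat filter_cat map_cat flatten_cat. Qed.

Lemma read_blocks_shift M M' k l :
  {in l, forall x, block_from M (k + x) = map (addn k) (block_from M' x)} ->
  {in l, forall x, starts_block M (k + x) = starts_block M' x} ->
  read_blocks M (map (addn k) l) = map (addn k) (read_blocks M' l).
Proof.
elim: l => //= a l IH hb hs.
rewrite -cat1s -[in RHS](cat1s a l) !read_blocks_cat map_cat IH; first last.
- by move=> x xl; apply: hs; rewrite inE xl orbT.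
- by move=> x xl; apply: hb; rewrite inE xl orbT.
congr (_ ++ _); rewrite /read_blocks /= hs ?mem_head //.
by case: ifP => //= _; rewrite !cats0 hb ?mem_head.
Qed.

Lemma starts_block1 M : starts_block M 1.
Proof.
apply/allP => c; rewrite mem_abscissas => hc; apply/implyP=> /linkP[]; lia.
Qed.

(** The first point of the path always starts a block, and this block is read last. It begins with
    1, so what is read before it is the part of the permutation to the left of 1. *)
Lemma read_blocks_abscissas M :
  read_blocks M (abscissas M) = read_blocks M (iota 2 (size M)) ++ block_from M 1.
Proof.
rewrite (_ : abscissas M = [:: 1] ++ iota 2 (size M)) // read_blocks_cat; congr (_ ++ _).
by rewrite /read_blocks /= starts_block1 /= cats0.
Qed.

Lemma filter_cons (T : Type) (P : pred T) x s :
  filter P (x :: s) = if P x then x :: filter P s else filter P s.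
Proof. by []. Qed.

Lemma all_cons (T : Type) (P : pred T) x s : all P (x :: s) = P x && all P s.
Proof. by []. Qed.

(** * Blocks after an initial flat-step *)

Section FlatStep.
Variable M : seq step.
Let M' := Flat :: M.

(** The initial flat-step lies on the line through the first point, so no proper part starting there
    can contain it. *)
Lemma link_flat1 y : 0 < y -> link (height_at M') 1 (1 + y) = false.
Proof.
move=> y0; apply/negbTE/negP=> /linkP[_ _ _ /(_ 1)].
by rewrite !height_at1 -[2]/(1 + 1) height_at_flat // height_at1 => /(_ _ erefl); apply; lia.
Qed.

Lemma link_flat x y : 0 < x -> link (height_at M') (1 + x) (1 + y) = link (height_at M) x y.
Proof.
by move=> x0; apply: (link_shift (c := 0%R)) => z hz; rewrite height_at_flat ?add0r //; lia.
Qed.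

Lemma abscissas_flat : abscissas M' = 1 :: map (addn 1) (abscissas M).
Proof. by rewrite /abscissas -iotaDl. Qed.

Lemma block_from_flat1 : block_from M' 1 = [:: 1].
Proof.
rewrite /block_from abscissas_flat filter_cons link_refl filter_map.
rewrite (@eq_in_filter _ _ pred0) ?filter_pred0 // => y; rewrite mem_abscissas => hy.
by rewrite /= link_flat1 //; lia.
Qed.

Lemma block_from_flat x : 0 < x -> block_from M' (1 + x) = map (addn 1) (block_from M x).
Proof.
move=> x0; rewrite /block_from abscissas_flat filter_cons link_gt; last by lia.
rewrite filter_map; congr map; apply: eq_in_filter => y _; exact: link_flat.
Qed.

Lemma starts_block_flat x : 0 < x -> starts_block M' (1 + x) = starts_block M x.
Proof.
move=> x0; rewrite /starts_block abscissas_flat all_cons link_flat1 // all_map.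
apply: eq_in_all => c; rewrite mem_abscissas => hc /=.
by rewrite link_flat ?eqn_add2l //; lia.
Qed.

End FlatStep.

(** * Blocks of an arch followed by a path *)

Section Arch.
Variables M1 M2 : seq step.
Let M' := Up :: M1 ++ Down :: M2.
(** The point of [M2] with abscissa [z] is drawn at [k + z], after the steps of [M1] and the two
    steps of the arch; that of [M1] is drawn at [1 + z]. *)
Let k := (size M1).+2.

Lemma abscissas_arch :
  abscissas M' = 1 :: map (addn 1) (abscissas M1) ++ map (addn k) (abscissas M2).
Proof.
rewrite /abscissas -!iotaDl (_ : k + 1 = 1 + 1 + (size M1).+1); last by rewrite /k; lia.
rewrite -iotaD -[RHS]/(iota 1 ((size M1).+1 + (size M2).+1).+1); congr iota.
by rewrite /M' /= size_cat /=; lia.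
Qed.

Hypothesis M1_ge0 : forall x, (0 <= height_at M1 x)%R.
Hypothesis M1_end : height_at M1 (size M1).+1 = 0%R.

Lemma link_arch11 x y : 0 < x -> y <= (size M1).+1 ->
  link (height_at M') (1 + x) (1 + y) = link (height_at M1) x y.
Proof.
by move=> x0 yM; apply: (link_shift (c := 1%R)) => z hz; rewrite height_at_arch1 //; lia.
Qed.

Lemma link_arch22 x y : 0 < x ->
  link (height_at M') (k + x) (k + y) = link (height_at M2) x y.
Proof.
move=> x0; apply: (link_shift (c := 0%R)) => z hz.
by rewrite height_at_arch2 ?add0r //; lia.
Qed.

Lemma link_arch01 y : 0 < y <= (size M1).+1 -> link (height_at M') 1 (1 + y) = false.
Proof.
move=> hy; apply/negbTE/negP=> /linkP[_].
by rewrite height_at1 height_at_arch1 //; have := M1_ge0 y; lia.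
Qed.

(** A point inside the arch has ordinate at least 1, and a part from there into [M2] would run below
    its base line at [k + 1], where the path is back on the ground. *)
Lemma link_arch12 x y : 0 < x <= (size M1).+1 -> 0 < y ->
  link (height_at M') (1 + x) (k + y) = false.
Proof.
move=> hx hy; apply/negbTE/negP=> /linkP[_ _ /(_ (k + 1)) + _].
rewrite height_at_arch1 // height_at_arch2 // height_at1 => /(_ _).
by have := M1_ge0 x; lia.
Qed.

(** The arch is itself a proper path on the ground line, which it meets only at its two ends. *)
Lemma link_arch0 : link (height_at M') 1 (k + 1).
Proof.
apply/linkP; split.
- by lia.
- by rewrite height_at_arch2 // !height_at1.
- move=> [|[|z]] hz; rewrite ?height_at1 //.
  have [hz1|hz1] := leqP z (size M1).
    by rewrite -[z.+2]add1n height_at_arch1 //; have := M1_ge0 z.+1; lia.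
  have -> : z.+2 = k + 1 by rewrite /k in hz *; lia.
  by rewrite height_at_arch2 // height_at1.
- rewrite height_at1 => -[|[|z]] hz; first by lia.
    by rewrite (height_at_arch1 _ (z := 1)) // !height_at1.
  rewrite (height_at_arch1 _ (z := z.+1)); first by have := M1_ge0 z.+1; lia.
  by rewrite /k in hz; lia.
Qed.

(** A part from 1 into [M2] passes through [k + 1] on its base line, and can be cut or glued
    there. *)
Lemma link_arch02 y : 0 < y -> link (height_at M') 1 (k + y) = link (height_at M2) 1 y.
Proof.
move=> y0; rewrite -link_arch22 //; apply/idP/idP.
- move=> L; apply: link_suffix L _ _; first by lia.
  by rewrite height_at_arch2 // !height_at1.
- exact: link_trans link_arch0.
Qed.

Lemma block_from_arch0 : block_from M' 1 = 1 :: map (addn k) (block_from M2 1).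
Proof.
rewrite /block_from abscissas_arch filter_cons link_refl filter_cat !filter_map; congr (_ :: _).
rewrite (@eq_in_filter _ _ pred0) ?filter_pred0 => [|y]; last first.
  by rewrite mem_abscissas => hy; rewrite [LHS]/= link_arch01.
congr map; apply: eq_in_filter => y; rewrite mem_abscissas => hy /=.
by rewrite link_arch02 //; lia.
Qed.

Lemma block_from_arch1 x : 0 < x <= (size M1).+1 ->
  block_from M' (1 + x) = map (addn 1) (block_from M1 x).
Proof.
move=> hx; rewrite /block_from abscissas_arch filter_cons link_gt; last by lia.
rewrite filter_cat !filter_map.
rewrite [X in _ ++ map _ X](@eq_in_filter _ _ pred0) ?filter_pred0 => [|y]; last first.
  by rewrite mem_abscissas => hy; rewrite [LHS]/= link_arch12 //; lia.
rewrite cats0; congr map; apply: eq_in_filter => y; rewrite mem_abscissas => hy.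
by rewrite [LHS]/= link_arch11 //; lia.
Qed.

Lemma block_from_arch2 x : 0 < x -> block_from M' (k + x) = map (addn k) (block_from M2 x).
Proof.
move=> x0; rewrite /block_from abscissas_arch filter_cons link_gt; last by lia.
rewrite filter_cat !filter_map.
rewrite (@eq_in_filter _ _ pred0) ?filter_pred0 => [|y]; last first.
  rewrite mem_abscissas => hy; apply/negbTE/negP=> /linkP[]; lia.
congr map; apply: eq_in_filter => y _; exact: link_arch22.
Qed.

Lemma starts_block_arch1 x : 0 < x <= (size M1).+1 ->
  starts_block M' (1 + x) = starts_block M1 x.
Proof.
move=> hx; rewrite /starts_block abscissas_arch all_cons link_arch01 // implyFb andTb.
rewrite all_cat !all_map.
rewrite [X in _ && X](_ : _ = true) ?andbT; last first.
  apply/allP=> c; rewrite mem_abscissas => hc /=.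
  by case: (boolP (link _ _ _)) => // /linkP[]; lia.
apply: eq_in_all => c; rewrite mem_abscissas => hc /=.
by rewrite link_arch11 ?eqn_add2l //; lia.
Qed.

(** The value [x = 1] is excluded because the first point of [M2] joins the block of abscissa 1. For
    the other points the new competitor 1 is linked exactly when [k + 1] is. *)
Lemma starts_block_arch2 x : 1 < x -> starts_block M' (k + x) = starts_block M2 x.
Proof.
move=> x1; rewrite /starts_block abscissas_arch all_cons all_cat !all_map.
rewrite [X in _ && (X && _)](_ : _ = true) ?andTb; last first.
  apply/allP=> c; rewrite mem_abscissas => hc; rewrite [preim _ _ _]/=.
  by rewrite link_arch12 //; lia.
rewrite link_arch02; last by lia.
rewrite (_ : (1 == _) = false) ?implybF; last by lia.
have -> : all (preim (addn k) (fun c => link (height_at M') c (k + x) ==> (c == k + x)))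
    (abscissas M2) = all (fun c => link (height_at M2) c x ==> (c == x)) (abscissas M2).
  apply: eq_in_all => c; rewrite mem_abscissas => hc /=.
  by rewrite link_arch22 ?eqn_add2l //; lia.
(* A link from 1 already violates the condition of [M2] at its first abscissa, so the extra conjunct
   changes nothing. *)
rewrite /=; case: (link _ 1 x) => //=.
by rewrite (_ : (1 == x) = false) //; lia.
Qed.

Lemma starts_block_arch12 : starts_block M' (k + 1) = false.
Proof.
apply/negbTE/negP=> /allP/(_ 1); rewrite mem_abscissas link_arch0 => /(_ isT); lia.
Qed.

End Arch.

(** By decreasing first elements, an arch followed by [M2] is read as follows: the blocks of [M2]
    other than the first one, all the blocks of [M1], and last the block of abscissa 1, which has
    absorbed the first block of [M2]. This is the recursion that defines [sides]. *)
Lemma read_blocks_word t :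
  read_blocks (word t) (iota 2 (size (word t))) = (sides t).1 /\
  block_from (word t) 1 = 1 :: (sides t).2.
Proof.
elim: t => [|t [IHu IHv]|t1 [IHu1 IHv1] t2 [IHu2 IHv2]].
- by split; rewrite // /block_from /= link_refl.
- split; last exact: block_from_flat1.
  rewrite [word _]/= [size _]/= (iotaDl 1 1) (@read_blocks_shift _ (word t)).
  + by rewrite read_blocks_abscissas IHu IHv.
  + by move=> x; rewrite mem_iota => hx; apply: block_from_flat; lia.
  + by move=> x; rewrite mem_iota => hx; apply: starts_block_flat; lia.
- have [e1 ge1] := word_height t1.
  have sz : size (around_one (sides t1)) = (size (word t1)).+1 by exact: size_perm_of.
  split; rewrite [word _]/= [sides _]/= sz; last by rewrite block_from_arch0 // IHv2.
  set M := _ :: _.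
  have -> : iota 2 (size M) = _ := congr1 behead (abscissas_arch (word t1) (word t2)).
  rewrite -[behead _]/(_ ++ _).
  rewrite read_blocks_cat (@read_blocks_shift _ (word t1) 1); first last.
  + by move=> x; rewrite mem_abscissas => hx; apply: starts_block_arch1.
  + by move=> x; rewrite mem_abscissas => hx; apply: block_from_arch1.
  rewrite read_blocks_abscissas IHu1 IHv1; congr (_ ++ _).
  (* The first point of [M2] is split off because it starts no block of the whole path. *)
  rewrite (_ : abscissas (word t2) = [:: 1] ++ iota 2 (size (word t2))) // map_cat read_blocks_cat.
  rewrite [X in _ ++ X]/read_blocks /= starts_block_arch12 // cats0.
  rewrite (@read_blocks_shift _ (word t2)) ?IHu2 // => x; rewrite mem_iota => hx.
  + by apply: block_from_arch2; lia.
  + by apply: starts_block_arch2 => //; lia.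
Qed.

Lemma psi_word t : psi (word t) = perm_of t.
Proof.
rewrite psiE; last by case: (word_height t).
by rewrite -/(read_blocks _ _) read_blocks_abscissas; have [-> ->] := read_blocks_word t.
Qed.

(** * The words of trees are the Motzkin paths *)

Lemma word_motzkin t : motzkin_on 0 0 (word t).
Proof.
have [e ge] := word_height t; apply/and3P; split=> //; first exact/eqP.
by apply/allP=> x _; exact: (ge x.+1).
Qed.

(* Each of the k trees in [ts] is preceded by the down-step closing one of the k
   arches still open at the start of [w]. *)
Lemma parse_from (k : nat) (w : seq step) :
  ordinate k%:Z w (size w) = 0%R ->
  (forall i, i <= size w -> (0 <= ordinate k%:Z w i)%R) ->
  exists t ts, size ts = k /\ w = word t ++ flatten [seq Down :: word t' | t' <- ts].
Proof.
have shift s w' i y : ordinate y (s :: w') i.+1 = ordinate (y + rise s)%R w' i.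
  by rewrite /ordinate /= big_cons addrA.
elim: w k => [|s w IH] k.
  rewrite /ordinate /= big_nil addr0 => -[->] _; by exists Leaf, [::].
rewrite /= shift => e ge.
have ge' i : i <= size w -> (0 <= ordinate (k%:Z + rise s)%R w i)%R.
  by move=> hi; rewrite -shift; apply: ge.
case: s e ge ge' => /= e ge ge'.
- have ek : (k%:Z + 1 = k.+1%:Z)%R by lia.
  rewrite ek in e ge'.
  have [t [[|t' ts] [//= [sts] ->]]] := IH _ e ge'.
  (* The first tree of the list follows the down-step matching this up-step, so it becomes the
     second subtree. *)
  by exists (ArchNode t t'), ts; rewrite /= -catA.
- case: k e ge ge' => [|k] e ge ge'.
    by have := ge' 0 isT; rewrite /ordinate take0 big_nil.
  have ek : (k.+1%:Z - 1 = k%:Z)%R by lia.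
  rewrite ek in e ge'.
  have [t [ts [sts ->]]] := IH _ e ge'.
  (* The down-step closes the innermost open arch at once, so the tree before it is empty and [t]
     becomes the first of the list. *)
  by exists Leaf, (t :: ts); rewrite /= sts.
- rewrite addr0 in e ge'.
  have [t [ts [sts ->]]] := IH _ e ge'.
  by exists (FlatNode t), ts.
Qed.

Lemma motzkin_word M : motzkin_on 0 0 M -> exists t, M = word t.
Proof.
case/and3P=> _ /eqP e /allP ge.
have [i hi|t [ts [/size0nil -> ->]]] := @parse_from 0 M e.
  by apply: ge; rewrite mem_iota; lia.
by exists t; rewrite cats0.
Qed.

(** * Relative order of the entries of a word *)

(** The order is stated for entries instead of positions, so that it passes through concatenations
    and shifts of values without arithmetic on positions. *)
Fixpoint before (w : seq nat) (x y : nat) : bool :=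
  if w is a :: w' then (a == x) && (y \in w') || before w' x y else false.

Lemma before_mem w x y : before w x y -> (x \in w) && (y \in w).
Proof.
elim: w => //= a w IH /orP[/andP[/eqP -> yw]|/IH /andP[xw yw]].
  by rewrite mem_head inE yw orbT.
by rewrite !inE xw yw !orbT.
Qed.

Lemma before_cat s1 s2 x y :
  before (s1 ++ s2) x y =
  [|| before s1 x y, before s2 x y | (x \in s1) && (y \in s2)].
Proof.
elim: s1 => [|a s IH] /=; first by rewrite orbF.
rewrite IH mem_cat inE [x == a]eq_sym.
by case: (a == x); case: (y \in s); case: (y \in s2); case: before; case: before; case: (x \in s).
Qed.

Lemma before_map f w x y : injective f -> before (map f w) (f x) (f y) = before w x y.
Proof.
by move=> fi; elim: w => //= a w ->; rewrite (inj_eq fi) (mem_map fi).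
Qed.

Lemma beforeE w x y : uniq w -> before w x y = (index x w < index y w < size w).
Proof.
elim: w => //= a w IH /andP[aw uw]; rewrite IH //.
have [<-|ax] := eqVneq a x.
  rewrite (memNindex aw).
  have [<-|ay] := eqVneq a y; first by rewrite (negbTE aw) (memNindex aw) /= ltnn.
  rewrite /= -index_mem !ltnS; case: (ltnP (index y w)) => // ?; lia.
by have [<-|ay] := eqVneq a y; rewrite /= ?(memNindex aw) ?ltnn ?andbF.
Qed.

Lemma before_asym w x y : uniq w -> before w x y -> before w y x -> False.
Proof. by move=> uw; rewrite !beforeE //; lia. Qed.

Lemma before_nth w i j : i < j -> j < size w -> before w (nth 0 w i) (nth 0 w j).
Proof.
elim: w i j => //= a w IH [|i] [|j] //= ij jw; last by rewrite IH ?orbT.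
by rewrite eqxx mem_nth.
Qed.

Lemma beforeP w x y : before w x y ->
  exists i j, [/\ i < j, j < size w, x = nth 0 w i & y = nth 0 w j].
Proof.
elim: w => //= a w IH /orP[/andP[/eqP -> /(nthP 0)[j jw <-]]|/IH[i [j [ij jw -> ->]]]].
  by exists 0, j.+1.
by exists i.+1, j.+1.
Qed.

(** * The two pattern conditions in terms of relative order *)

Definition no_132 (w : seq nat) : Prop :=
  forall x y z, x < z -> z < y -> before w x y -> before w y z -> False.

(** In an occurrence of 213 an ascent can only play the letters 2 and 3, with the letter 1 found
    between them, or the letters 1 and 3, with the letter 2 found in front. *)
Definition ascents_in_213 (w : seq nat) : Prop :=
  forall x y, x < y -> before w x y ->
    (exists z, [/\ z < x, before w x z & before w z y]) \/
    (exists z, [/\ x < z, z < y & before w z x]).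

Definition good (w : seq nat) : Prop :=
  [/\ perm_eq w (iota 1 (size w)), no_132 w & ascents_in_213 w].

Ltac compare_three a b c :=
  rewrite /red /sort /=;
  case: (ltngtP a b) => [?|?|<-] /=; case: (ltngtP b c) => [?|?|?] /=;
  case: (ltngtP a c) => [?|?|?] /=; subst; rewrite /= ?leqnn /= ?eqxx;
  do ?[case: ifP => /eqP ?]; first [done | lia].

Lemma red_132 a b c : (red [:: a; b; c] == [:: 1; 3; 2]) = (a < c < b).
Proof. compare_three a b c. Qed.

Lemma red_213 a b c : (red [:: a; b; c] == [:: 2; 1; 3]) = (b < a < c).
Proof. compare_three a b c. Qed.

Lemma S_avoidingP m w : S_avoiding m w <-> size w = m /\ good w.
Proof.
rewrite /S_avoiding /=; split.
- case=> pw n132 n213.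
  have sw : size w = m by rewrite (perm_size pw) size_iota.
  have uw : uniq w by rewrite (perm_uniq pw) iota_uniq.
  split=> //; split; first by rewrite sw.
  + move=> x y z xz zy bxy byz; apply: n132.
    have [i [j [ij jw ex ey]]] := beforeP bxy.
    have [j' [k [jk kw ey' ez]]] := beforeP byz.
    (* The two pairs must share the position of [y], which is unique in a word without
       repetition. *)
    have ejj : j = j'.
      apply/eqP; rewrite -(nth_uniq 0 jw _ uw); last exact: ltn_trans kw.
      by rewrite -ey -ey'.
    rewrite -{}ejj in jk.
    by exists i, j, k; rewrite /occurs_at ij jk kw -ex -ey -ez red_132 xz zy.
  + move=> x y xy bxy; have [i [j [ij jw ex ey]]] := beforeP bxy.
    have [t1 [t2 [t3 [/and4P[t12 t23 tw]]]]] := n213 i j ij jw ltac:(by rewrite -ex -ey).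
    rewrite red_213 => /andP[h21 h13] sub.
    have := sub i; have := sub j; rewrite !inE !eqxx ?orbT => /(_ isT) hj /(_ isT) hi.
    (* The first two letters of 213 form a descent, so they cannot be the given ascent. *)
    have [[ei ej]|[ei ej]] : (i = t1 /\ j = t3) \/ (i = t2 /\ j = t3).
      suff : ~ (i = t1 /\ j = t2) by lia.
      by case=> ei ej; move: h21 xy; rewrite ex ey ei ej; lia.
    * left; exists (nth 0 w t2); rewrite ex ey ei ej.
      by split=> //; apply: before_nth => //; exact: ltn_trans tw.
    * right; exists (nth 0 w t1); rewrite ex ey ei ej.
      by split=> //; apply: before_nth => //; exact: ltn_trans tw.
- case=> sw [pw n132 n213]; have uw : uniq w by rewrite (perm_uniq pw) iota_uniq.
  split; first by rewrite -sw.
  + case=> i [j [k /and4P[ij jk kw]]]; rewrite red_132 => /andP[h1 h2].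
    by apply: (n132 _ _ _ h1 h2); apply: before_nth => //; apply: ltn_trans kw.
  + move=> i j ij jw hij.
    have idx x y : before w x y -> index x w < index y w < size w by rewrite beforeE.
    have mem x y : before w x y -> nth 0 w (index x w) = x /\ nth 0 w (index y w) = y.
      by move=> /before_mem/andP[? ?]; rewrite !nth_index.
    have ei : index (nth 0 w i) w = i by rewrite index_uniq //; exact: ltn_trans jw.
    have ej : index (nth 0 w j) w = j by rewrite index_uniq.
    have [[z [zi b1 b2]]|[z [iz zj b1]]] := n213 _ _ hij (before_nth ij jw).
    * have := idx _ _ b1; have := idx _ _ b2; have [ez _] := mem _ _ b2.
      rewrite ei ej => h2 h1; exists i, (index z w), j; split.
        by rewrite /occurs_at red_213 ez zi hij; lia.
      by move=> t; rewrite !inE => /orP[] /eqP ->; rewrite eqxx ?orbT.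
    * have := idx _ _ b1; have [ez _] := mem _ _ b1.
      rewrite ei => h1; exists (index z w), i, j; split.
        by rewrite /occurs_at red_213 ez iz zj; lia.
      by move=> t; rewrite !inE => /orP[] /eqP ->; rewrite eqxx ?orbT.
Qed.

(** A smallest entry in last place belongs to no ascent, and to no occurrence of 132 or 213, since
    neither pattern ends in its smallest letter. *)
Lemma good_flat w : good (map (addn 1) w ++ [:: 1]) <-> good w.
Proof.
set w' := _ ++ _.
have perm_eqE : perm_eq w' (iota 1 (size w')) = perm_eq w (iota 1 (size w)).
  rewrite /w' size_cat size_map addn1 perm_catC /= perm_cons.
  rewrite (iotaDl 1 1); apply/idP/idP => [|h]; last exact: perm_map.
  by apply: perm_map_inj; exact: addnI.
(* The final entry is written [1 + 0]; the second disjunct says that all shifted entries precede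
   it. *)
have bS x y : before w' (1 + x) (1 + y) = before w x y || (x \in w) && (y == 0).
  rewrite before_cat before_map; last exact: addnI.
  by rewrite (mem_map (@addnI 1)) inE /= andbF orFb.
have memP x y : before w' x y -> 0 < x /\ 0 < y.
  move=> /before_mem; rewrite !mem_cat !inE.
  by case/andP=> /orP[/mapP[? _ ->]|/eqP ->] /orP[/mapP[? _ ->]|/eqP ->].
have pos_mem : perm_eq w (iota 1 (size w)) -> forall x, x \in w -> 0 < x.
  by move=> pw x; rewrite (perm_mem pw) mem_iota; lia.
have bSw x y : perm_eq w (iota 1 (size w)) -> before w' (1 + x) (1 + y) ->
    before w x y \/ y = 0.
  by move=> /pos_mem pw; rewrite bS => /orP[|/andP[_ /eqP]]; [left | right].
split=> -[pw n132 n213].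
- have pw' : perm_eq w (iota 1 (size w)) by rewrite -perm_eqE.
  have pos x y : before w x y -> 0 < x /\ 0 < y.
    by move=> /before_mem/andP[/(pos_mem pw') ? /(pos_mem pw') ?].
  split=> //.
  + move=> x y z xz zy bxy byz; apply: (n132 (1 + x) (1 + y) (1 + z)) => //.
    * by rewrite bS bxy.
    * by rewrite bS byz.
  + move=> x y xy bxy.
    have [||[[|z] [zx b1 b2]]|[[|z] [xz zy b1]]] := n213 (1 + x) (1 + y).
    * exact: xy.
    * by rewrite bS bxy.
    * by have [] := memP _ _ b1.
    * have [b2'|y0] := bSw z y pw' b2; last by have := pos _ _ bxy; lia.
      have [b1'|z0] := bSw x z pw' b1; last by have := pos _ _ b2'; lia.
      by left; exists z.
    * by have [] := memP _ _ b1.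
    * have [b1'|x0] := bSw z x pw' b1; last by have := pos _ _ bxy; lia.
      by right; exists z.
- split=> //; first by rewrite perm_eqE.
  + move=> [|x] [|y] [|z] //= xz zy bxy byz; try by have := memP _ _ bxy; lia.
    have [bxy'|?] := bSw x y pw bxy; last by lia.
    have [byz'|?] := bSw y z pw byz; last by lia.
    exact: n132 bxy' byz'.
  + move=> [|x] [|y] //= xy bxy; try by have := memP _ _ bxy; lia.
    have [bxy'|?] := bSw x y pw bxy; last by lia.
    have [[z [zx b1 b2]]|[z [xz zy b1]]] := n213 x y xy bxy'.
    * by left; exists (1 + z); rewrite -[x.+1]add1n -[y.+1]add1n !bS b1 b2.
    * by right; exists (1 + z); rewrite -[x.+1]add1n !bS b1.
Qed.

(** * Decomposition of the avoiding permutations *)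

Lemma before_cons a w x y : before (a :: w) x y = (a == x) && (y \in w) || before w x y.
Proof. by []. Qed.

Section Arch.
Variables (p1 u v : seq nat).
Let s := size p1.
Let k := s.+1.
Let p2 := around_one (u, v).
Definition arch_perm : seq nat :=
  map (addn k) u ++ map (addn 1) p1 ++ 1 :: map (addn k) (1 :: v).

Lemma size_arch_perm : size arch_perm = (s + size p2).+1.
Proof. by rewrite /arch_perm /p2 /around_one /= !(size_cat, size_map) /= !size_map; lia. Qed.

Hypothesis perm1 : perm_eq p1 (iota 1 s).

(** The values are 1, those from 2 to [k], filled by [p1], and those above [k], left to [p2]. *)
Lemma perm_arch_perm :
  perm_eq arch_perm (iota 1 (size arch_perm)) = perm_eq p2 (iota 1 (size p2)).
Proof.
have /permPl -> : perm_eq arch_perm (1 :: map (addn 1) p1 ++ map (addn k) p2).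
  rewrite /p2 /around_one map_cat /arch_perm perm_sym -cat1s perm_catC /=.
  by apply/permP => a; rewrite !(count_cat, count_map) /= !count_map; lia.
rewrite size_arch_perm -[(s + _).+1]add1n iotaD -cat1s perm_cat2l iotaD.
have -> : iota (1 + 1) s = map (addn 1) (iota 1 s) by rewrite -iotaDl.
have -> : iota (1 + 1 + s) (size p2) = map (addn k) (iota 1 (size p2)).
  by rewrite -iotaDl; congr iota; rewrite /k; lia.
have h := perm_cat (perm_map (addn 1) perm1) (perm_refl (map (addn k) (iota 1 (size p2)))).
rewrite -(permPr h) perm_cat2l; apply/idP/idP => [|e]; last exact: perm_map.
by apply: perm_map_inj; exact: addnI.
Qed.

Hypothesis perm2 : perm_eq p2 (iota 1 (size p2)).

(** * Relative order of the entries of an arch permutation *)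

Lemma mem_p1 x : (x \in p1) = (0 < x <= s).
Proof. by rewrite (perm_mem perm1) mem_iota; lia. Qed.

Lemma p1_le x : x \in p1 -> x <= s.
Proof. by rewrite mem_p1 => /andP[]. Qed.

Lemma mem_p2_gt0 x : x \in p2 -> 0 < x.
Proof. by rewrite (perm_mem perm2) mem_iota; lia. Qed.

Lemma uniq_p2 : uniq p2.
Proof. by rewrite (perm_uniq perm2) iota_uniq. Qed.

Lemma mem_shift_small w y : 0 \notin w -> y <= k -> (y \in map (addn k) w) = false.
Proof.
move=> w0 yk; apply/negP=> /mapP[[|x] xw e]; last by lia.
by rewrite xw in w0.
Qed.

Lemma mem_shift_large x : 0 < x -> (k + x \in map (addn 1) p1) = false.
Proof. by move=> x0; apply/negP=> /mapP[z]; rewrite mem_p1 /k; lia. Qed.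

Lemma before_notin w x y : (x \notin w) || (y \notin w) -> before w x y = false.
Proof. by apply: contraTF => /before_mem/andP[-> ->]. Qed.

Let u0 : 0 \notin u.
Proof. by apply/negP=> h; have := @mem_p2_gt0 0; rewrite mem_cat h => /(_ isT). Qed.

Let v0 : 0 \notin 1 :: v.
Proof. by apply/negP=> h; have := @mem_p2_gt0 0; rewrite mem_cat h orbT => /(_ isT). Qed.

Lemma mem_one_v x : x \in p2 -> (x \in 1 :: v) = (x \notin u).
Proof.
move=> xp; have := uniq_p2; rewrite cat_uniq => /and3P[_ /hasPn d _].
move: xp; rewrite mem_cat => /orP[xu|xv].
  by rewrite xu; apply/negbTE/negP => /d; rewrite /= xu.
by rewrite xv (d x xv).
Qed.

Lemma mem_p1_shift x w : x \in p1 -> 0 \notin w -> (1 + x \in map (addn k) w) = false.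
Proof. by rewrite mem_p1 => hx w0; rewrite mem_shift_small // /k; lia. Qed.

Lemma one_shift w : 0 \notin w -> (1 \in map (addn k) w) = false.
Proof. by move=> w0; rewrite mem_shift_small. Qed.

Lemma one_p1 : (1 \in map (addn 1) p1) = false.
Proof. by apply/negP=> /mapP[z]; rewrite mem_p1; lia. Qed.

Lemma arch_before11 x y : x \in p1 -> y \in p1 ->
  before arch_perm (1 + x) (1 + y) = before p1 x y.
Proof.
move=> xp yp; have x0 : 1 == 1 + x = false by move: xp; rewrite mem_p1; lia.
have y0 : 1 + y == 1 = false by move: yp; rewrite mem_p1; lia.
rewrite /arch_perm !before_cat before_map; last exact: addnI.
rewrite mem_p1_shift // before_cons x0 (in_cons 1 (map _ _)) y0 !mem_p1_shift //.
by rewrite !(before_notin (x := 1 + x)) ?mem_p1_shift //= !andbF !orbF.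
Qed.

Lemma arch_before22 x y : x \in p2 -> y \in p2 ->
  before arch_perm (k + x) (k + y) = before p2 x y.
Proof.
move=> /mem_p2_gt0 x0 /mem_p2_gt0 y0.
rewrite /arch_perm !before_cat !(before_map _ _ _ (@addnI k)).
rewrite (before_notin (w := map _ p1)) ?mem_shift_large //.
rewrite (before_cons 1 (map _ _)) before_map; last exact: addnI.
rewrite mem_cat ?mem_shift_large // (in_cons 1 (map _ _)).
have -> : 1 == k + x = false by lia.
have -> : k + y == 1 = false by lia.
rewrite !(mem_map (@addnI k)) /=.
by rewrite orbF.
Qed.

Lemma arch_before12 x y : x \in p1 -> y \in p2 ->
  before arch_perm (1 + x) (k + y) = (y \in 1 :: v).
Proof.
move=> xp yp; have y0 := mem_p2_gt0 yp.
have x0 : 1 == 1 + x = false by move: xp; rewrite mem_p1; lia.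
rewrite /arch_perm !before_cat before_cons x0.
rewrite (mem_p1_shift xp) // !before_notin ?(mem_p1_shift xp) ?mem_shift_large ?orbT //.
rewrite (mem_map (@addnI 1)) xp (in_cons 1 (map _ _)) (mem_map (@addnI k)).
by rewrite (_ : k + y == 1 = false) ?orbF //; lia.
Qed.

Lemma arch_before21 x y : x \in p2 -> y \in p1 ->
  before arch_perm (k + x) (1 + y) = (x \in u).
Proof.
move=> xp yp; have x0 := mem_p2_gt0 xp.
have y0 : 1 + y == 1 = false by move: yp; rewrite mem_p1; lia.
rewrite /arch_perm !before_cat before_cons.
rewrite !(before_notin (y := 1 + y)) ?(mem_p1_shift yp) ?mem_shift_large ?orbT //.
rewrite !mem_cat !(mem_map (@addnI _)) yp (in_cons 1 (map _ _)) y0.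
by rewrite (mem_p1_shift yp) // !andbF !andbT.
Qed.

Lemma arch_before1l y : y \in p2 -> before arch_perm 1 (k + y) = (y \in 1 :: v).
Proof.
move=> yp; rewrite /arch_perm !before_cat before_cons one_shift // one_p1.
rewrite !(before_notin (x := 1)) ?one_shift ?one_p1 //.
by rewrite (mem_map (@addnI k)) !orbF.
Qed.

Lemma arch_before2r x : x \in p2 -> before arch_perm (k + x) 1 = (x \in u).
Proof.
move=> xp; have x0 := mem_p2_gt0 xp.
rewrite /arch_perm !before_cat before_cons.
rewrite !(before_notin (y := 1)) ?one_shift ?one_p1 ?orbT //.
have x1 : 1 == k + x = false by lia.
by rewrite x1 mem_shift_large // (mem_map (@addnI k)) mem_cat mem_head orbT !andbT /=.
Qed.

Lemma arch_before1r x : x \in p1 -> before arch_perm (1 + x) 1.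
Proof.
by move=> xp; rewrite /arch_perm !before_cat (mem_map (@addnI 1)) xp mem_head !orbT.
Qed.

Lemma uniq_arch_perm : uniq arch_perm.
Proof.
rewrite (perm_uniq (_ : perm_eq _ (iota 1 (size arch_perm)))) ?iota_uniq //.
by rewrite perm_arch_perm.
Qed.

Lemma before_arch1l y : y \in p1 -> before arch_perm 1 (1 + y) = false.
Proof.
move=> yp; apply/negP; apply: before_asym uniq_arch_perm _; exact: arch_before1r.
Qed.

(** Case analysis on this type rewrites an entry into the form in which the order lemmas above
    apply. *)
Variant arch_spec : nat -> Type :=
  | ArchOne : arch_spec 1
  | ArchInner x of x \in p1 : arch_spec (1 + x)
  | ArchOuter x of x \in p2 : arch_spec (k + x).

Lemma archP x : x \in arch_perm -> arch_spec x.
Proof.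
rewrite (perm_mem (_ : perm_eq _ (iota 1 (size arch_perm)))) ?perm_arch_perm //.
rewrite mem_iota size_arch_perm => hx.
have [x1|x1] := eqVneq x 1; first by rewrite x1; constructor.
have [xk|xk] := leqP x k.
  have -> : x = 1 + x.-1 by lia.
  by apply: ArchInner; rewrite mem_p1; move: xk; rewrite /k; lia.
have -> : x = k + (x - k) by lia.
by apply: ArchOuter; rewrite (perm_mem perm2) mem_iota; move: xk; rewrite /k; lia.
Qed.

Lemma before_archP x y : before arch_perm x y -> arch_spec x * arch_spec y.
Proof. by move=> /before_mem/andP[/archP hx /archP hy]. Qed.

(** A descent to the right of 1 would form a 132 together with this 1. *)
Lemma after_one_increasing x y : no_132 p2 ->
  x \in 1 :: v -> before p2 x y -> x < y.
Proof.
move=> n132 xv bxy; have /andP[xp yp] := before_mem bxy; have up := uniq_p2.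
have x0 := mem_p2_gt0 xp; have y0 := mem_p2_gt0 yp.
have xy : x != y by apply/eqP=> e; subst y; exact: (before_asym up bxy bxy).
have [x1|x1] := eqVneq x 1; first by rewrite x1 ltn_neqAle -x1 xy x1.
have {}xv : x \in v by move: xv; rewrite inE (negbTE x1).
have b1x : before p2 1 x by rewrite before_cat /= xv orbT.
rewrite ltn_neqAle xy leqNgt; apply/negP=> yx.
have [y1|y1] := eqVneq y 1; first by subst y; exact: (before_asym up bxy b1x).
by apply: (n132 1 x y) => //; rewrite ltn_neqAle eq_sym y1.
Qed.

(** In a mixed occurrence the smallest entry is 1 or comes from [p1], and the largest comes from
    [p2], hence stands to the right of 1. There no entry of [p1] follows it, and the entries of [p2]
    increase, so the last letter cannot be found. *)
Lemma no_132_arch : no_132 arch_perm <-> no_132 p1 /\ no_132 p2.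
Proof.
split=> [n132|[n1 n2] x y z xz zy bxy byz].
- split=> x y z xz zy bxy byz;
    have /andP[xp yp] := before_mem bxy; have /andP[_ zp] := before_mem byz.
  + by apply: (n132 (1 + x) (1 + y) (1 + z)); rewrite ?ltn_add2l ?arch_before11.
  + by apply: (n132 (k + x) (k + y) (k + z)); rewrite ?ltn_add2l ?arch_before22.
- have [hx hy] := before_archP bxy; have [_ hz] := before_archP byz.
  have outer y' z' : y' \in p2 -> z' \in p2 -> y' \in 1 :: v -> k + z' < k + y' ->
      before arch_perm (k + y') (k + z') -> False.
    move=> yp zp yv zy'; rewrite arch_before22 // => b.
    by rewrite ltn_add2l ltnNge ltnW // (after_one_increasing n2 yv b) in zy'.
  case: hx hy hz xz zy bxy byz => [|x' xp|x' xp] [|y' yp|y' yp] [|z' zp|z' zp] xz zy bxy byz;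
    try (by clear -xz zy; lia);
    try (by have := p1_le zp; rewrite /k in xz; clear -xz; lia);
    try (by have := p1_le yp; rewrite /k in zy; clear -zy; lia).
  + by rewrite before_arch1l in bxy.
  + by rewrite arch_before1l // mem_one_v // -(arch_before21 yp zp) byz in bxy.
  + by rewrite arch_before1l // in bxy; exact: (outer _ _ yp zp bxy zy byz).
  + rewrite !arch_before11 // in bxy byz.
    by move: bxy byz; apply: n1; lia.
  + by rewrite arch_before12 // mem_one_v // -(arch_before21 yp zp) byz in bxy.
  + by rewrite arch_before12 // in bxy; exact: (outer _ _ yp zp bxy zy byz).
  + rewrite !arch_before22 // in bxy byz.
    by move: bxy byz; apply: n2; lia.
Qed.

(** Ascents inside [p1] or [p2] keep their witnesses. An ascent from [p1] to [p2] has the entry 1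
    between its ends; an ascent starting at 1 needs an entry of [p1] in front, whence [0 < s]. *)
Lemma ascents_arch : 0 < s ->
  ascents_in_213 arch_perm <-> ascents_in_213 p1 /\ ascents_in_213 p2.
Proof.
move=> s0; have q1 : 1 \in p1 by rewrite mem_p1.
split=> [asc|[a1 a2] x y xy bxy].
- split=> x y xy bxy; have /andP[xp yp] := before_mem bxy.
  + have [||[z [zx b1 b2]]|[z [xz zy b1]]] := asc (1 + x) (1 + y).
    * by lia.
    * by rewrite arch_before11.
    * have [_ hz] := before_archP b1; case: hz zx b1 b2 => [|z' zp|z' zp] zx b1 b2.
      - by rewrite before_arch1l in b2.
      - by left; exists z'; rewrite -!arch_before11.
      - by have := p1_le xp; rewrite /k in zx; clear -zx; lia.
    * have [hz _] := before_archP b1; case: hz xz zy b1 => [|z' zp|z' zp] xz zy b1.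
      - by clear -xz; lia.
      - by right; exists z'; rewrite -!arch_before11.
      - by have := p1_le yp; rewrite /k in zy; clear -zy; lia.
  + have x0 := mem_p2_gt0 xp.
    have [||[z [zx b1 b2]]|[z [xz zy b1]]] := asc (k + x) (k + y).
    * by lia.
    * by rewrite arch_before22.
    (* A witness from outside [p2] lies between the two ends only if they are on different sides of
       the 1 of [p2], and then this 1 replaces it. *)
    * have across : x \in u -> y \in 1 :: v ->
          (exists z, [/\ z < x, before p2 x z & before p2 z y]) \/
          (exists z, [/\ x < z, z < y & before p2 z x]).
        move=> xu yv; have x1 : x != 1.
          by apply/eqP=> e; move: (mem_one_v xp); rewrite xu e mem_head.
        have yv' : y \in v.
          move: yv; rewrite inE => /orP[/eqP y1|//].
          by rewrite y1 ltnS leqNgt x0 in xy.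
        left; exists 1; split; first by rewrite ltn_neqAle eq_sym x1.
          by rewrite before_cat xu mem_head !orbT.
        by rewrite before_cat before_cons eqxx yv' orbT.
      have [_ hz] := before_archP b1; case: hz zx b1 b2 => [|z' zp|z' zp] zx b1 b2.
      - by apply: across; [rewrite -arch_before2r | rewrite -arch_before1l].
      - by apply: across; [rewrite -(arch_before21 xp zp) | rewrite -(arch_before12 zp yp)].
      - by rewrite ltn_add2l in zx; left; exists z'; rewrite -!arch_before22.
    * have [hz _] := before_archP b1; case: hz xz zy b1 => [|z' zp|z' zp] xz zy b1.
      - by clear -xz; lia.
      - by have := p1_le zp; rewrite /k in xz; clear -xz; lia.
      - by rewrite !ltn_add2l in xz zy; right; exists z'; rewrite -!arch_before22.
- have [hx hy] := before_archP bxy.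
  case: hx hy xy bxy => [|x' xp|x' xp] [|y' yp|y' yp] xy bxy.
  + by lia.
  + by rewrite before_arch1l in bxy.
  (* The value 2 is the shifted 1 of [p1]; it stands to the left of 1 and is below every shifted
     entry of [p2]. *)
  + right; exists (1 + 1); split=> //; last exact: arch_before1r.
    by have := mem_p2_gt0 yp; rewrite /k; lia.
  + by move: xy; rewrite mem_p1 in xp; lia.
  + rewrite arch_before11 // in bxy.
    have [|[z [zx b1 b2]]|[z [xz zy b1]]] := a1 x' y' _ bxy; first by lia.
    * have /andP[_ zp] := before_mem b1.
      by left; exists (1 + z); rewrite !arch_before11.
    * have /andP[zp _] := before_mem b1.
      by right; exists (1 + z); rewrite !arch_before11.
  + left; exists 1; split; first by move: xp; rewrite mem_p1; lia.
      exact: arch_before1r.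
    by rewrite arch_before1l // -(arch_before12 xp yp).
  + by move: xy; rewrite /k; lia.
  + by move: xy; have := mem_p1 y'; rewrite yp /k; lia.
  + rewrite arch_before22 // in bxy.
    have [|[z [zx b1 b2]]|[z [xz zy b1]]] := a2 x' y' _ bxy; first by lia.
    * have /andP[_ zp] := before_mem b1.
      by left; exists (k + z); rewrite !arch_before22 // ltn_add2l.
    * have /andP[zp _] := before_mem b1.
      by right; exists (k + z); rewrite !arch_before22 // !ltn_add2l.
Qed.

End Arch.

Lemma good_arch p1 u v : 0 < size p1 -> perm_eq p1 (iota 1 (size p1)) ->
  good (arch_perm p1 u v) <-> good p1 /\ good (around_one (u, v)).
Proof.
move=> s0 perm1; split.
- case; rewrite perm_arch_perm // => perm2 /(no_132_arch perm1 perm2)[n1 n2].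
  by move=> /(ascents_arch perm1 perm2 s0)[a1 a2].
- case=> -[_ n1 a1] [perm2 n2 a2]; split; first by rewrite perm_arch_perm.
    by apply/(no_132_arch perm1 perm2).
  by apply/(ascents_arch perm1 perm2 s0).
Qed.

Lemma perm_of_arch t1 t2 :
  perm_of (ArchNode t1 t2) = arch_perm (perm_of t1) (sides t2).1 (sides t2).2.
Proof. exact: esym (catA _ _ _). Qed.

(** * Permutations of trees: avoidance and injectivity *)

Lemma good_perm_of t : good (perm_of t).
Proof.
elim: t => [|t IH|t1 IH1 t2 IH2].
- by split=> // [x y z _ _|x y _]; rewrite /= andbF.
- exact/good_flat.
- rewrite perm_of_arch; apply/good_arch.
  + by rewrite size_perm_of.
  + by case: IH1.
  + by split=> //; rewrite -surjective_pairing.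
Qed.

Lemma good_uniq w : good w -> uniq w.
Proof. by case=> pw _ _; rewrite (perm_uniq pw) iota_uniq. Qed.

Lemma cat_cons_inj (T : eqType) (x : T) u v u' v' : x \notin u -> x \notin u' ->
  u ++ x :: v = u' ++ x :: v' -> u = u' /\ v = v'.
Proof.
elim: u u' => [|a u IH] [|a' u'] /=; rewrite ?inE ?negb_or.
- by move=> _ _ [->].
- by move=> _ /andP[/eqP xa _] [].
- by move=> /andP[/eqP xa _] _ [/esym].
- by move=> /andP[_ xu] /andP[_ xu'] [-> /(IH _ xu xu')[-> ->]].
Qed.

Lemma around_one_inj uv uv' :
  uniq (around_one uv) -> around_one uv = around_one uv' -> uv = uv'.
Proof.
have one_notin p : uniq (around_one p) -> 1 \notin p.1.
  by rewrite cat_uniq /= negb_or => /and3P[_ /andP[]].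
move=> un e; have un' : uniq (around_one uv') by rewrite -e.
have [] := cat_cons_inj (one_notin _ un) (one_notin _ un') e.
by case: uv uv' {un un' e} => u v [u' v'] /= -> ->.
Qed.

(** The right side is nonempty exactly for an arch. Its first entry is then [size p1 + 2], which
    gives the shift and the place where the left side splits; a leaf and a flat node differ by the
    emptiness of the left side. *)
Lemma sides_inj : injective sides.
Proof.
have shift_inj k := inj_map (@addnI k).
have uo t := good_uniq (good_perm_of t).
elim=> [|t IH|t1 IH1 t2 IH2] [|t'|t1' t2'] //.
- by move=> /(congr1 (fun p => size p.1)); rewrite /= size_map -/(perm_of _) size_perm_of.
- by move=> /(congr1 (fun p => size p.1)); rewrite /= size_map -/(perm_of _) size_perm_of.
- by case=> /shift_inj /(around_one_inj (uo t)) /IH ->.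
- case=> + ek; have {}ek : size (around_one (sides t1)) = size (around_one (sides t1')).
    by lia.
  rewrite ek => eu /shift_inj ev.
  have su : size (sides t2).1 = size (sides t2').1.
    by move: (congr1 size eu); rewrite !size_cat !size_map ek; lia.
  move: eu => /eqP; rewrite eqseq_cat ?size_map // => /andP[/eqP/shift_inj eu /eqP/shift_inj].
  move=> /(around_one_inj (uo t1))/IH1 ->; congr ArchNode; apply: IH2.
  by rewrite (surjective_pairing (sides t2)) eu ev -surjective_pairing.
Qed.

(** * Recovering a tree from an avoiding permutation *)

Lemma cat_filter (P : pred nat) w :
  (forall x y, before w x y -> P y -> P x) -> w = filter P w ++ filter (predC P) w.
Proof.
elim: w => //= a w IH hw.
have hw' x y : before w x y -> P y -> P x by move=> b; apply: hw; rewrite b orbT.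
case: ifP => Pa /=; first by rewrite {1}IH.
have nP y : y \in w -> P y = false.
  by move=> yw; apply/negP=> Py; move: Pa; rewrite (hw a y) ?eqxx ?yw.
rewrite (eq_in_filter (a2 := pred0)) ?filter_pred0 //=; congr (_ :: _).
by rewrite -[LHS]filter_predT; apply: eq_in_filter => y yw; rewrite /= nP.
Qed.

(** Up to shifts, [u] and [p1] are the entries of [A] above and below [b], and [v] is [C]. *)
Lemma good_split_arch A b C : good (A ++ 1 :: b :: C) ->
  exists p1 u v, [/\ 0 < size p1, perm_eq p1 (iota 1 (size p1)) &
                     A ++ 1 :: b :: C = arch_perm p1 u v].
Proof.
set w := _ ++ _ => gw; have uw := good_uniq gw; have [pw n132 asc] := gw.
have w0 x : x \in w -> 0 < x by rewrite (perm_mem pw) mem_iota; lia.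
have [uA oneA bA [oneb bC]] :
    [/\ uniq A, 1 \notin A, b \notin A & 1 \notin b :: C /\ b \notin C].
  by move: uw; rewrite cat_uniq /= !negb_or => /and3P[-> /and3P[-> -> _] /and3P[-> -> _]].
have bw : b \in w by rewrite mem_cat !inE eqxx !orbT.
have b1 : 1 < b.
  rewrite ltn_neqAle w0 // andbT; by apply: contraNneq oneb => ->; rewrite mem_head.
have b1b : before w 1 b by rewrite before_cat /= mem_head orbT.
have Cb x : x \in C -> b < x.
  move=> xC; rewrite ltnNge leq_eqVlt; apply/negP=> /orP[/eqP e|xb].
    by rewrite -e xC in bC.
  have bbx : before w b x by rewrite before_cat /= eqxx xC !orbT.
  have x0 : 1 < x.
    rewrite ltn_neqAle w0 ?andbT; last by rewrite mem_cat !inE xC !orbT.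
    by apply: contraNneq oneb => ->; rewrite inE xC orbT.
  exact: n132 x0 xb b1b bbx.
(* An entry below [b] followed in [A] by one above [b] would form a 132 with [b] as last letter. *)
have Asplit : A = filter (fun x => b < x) A ++ filter (predC (fun x => b < x)) A.
  apply: cat_filter => x y bxy yb; rewrite ltnNge leq_eqVlt; apply/negP.
  have /andP[xA yA] := before_mem bxy.
  case/orP=> [/eqP e|xb]; first by rewrite -e xA in bA.
  apply: (n132 x y b xb yb); rewrite before_cat ?bxy //.
  by rewrite yA !inE eqxx !orbT.
set A1 := filter _ A in Asplit; set A2 := filter _ A in Asplit.
have memA2 x : (x \in A2) = (x \in A) && (x < b).
  rewrite mem_filter /= -leqNgt leq_eqVlt andbC; case xA: (x \in A) => //=.
  by case: eqP => // e; rewrite -e xA in bA.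
(* All the values strictly between 1 and [b] must occur in [A], because the entries of [C] exceed
   [b]. *)
have mem2 x : (x \in A2) = (1 < x < b).
  rewrite memA2; apply/andP/andP=> [[xA xb]|[x1 xb]]; split=> //.
    rewrite ltn_neqAle w0 ?andbT; last by rewrite mem_cat xA.
    by apply: contraNneq oneA => ->.
  have : x \in w.
    rewrite (perm_mem pw) mem_iota; move: bw; rewrite (perm_mem pw) mem_iota; lia.
  by rewrite mem_cat !inE => /or4P[//|/eqP|/eqP|/Cb]; clear -x1 xb; lia.
(* The ascent from 1 to [b] has a witness; it cannot be below 1, so it lies strictly between the
   two. *)
have b2 : 2 < b.
  have [[z [z1 bz _]]|[z [z1 zb _]]] := asc 1 b b1 b1b; last exact: leq_trans zb.
  by have /andP[_ /w0] := before_mem bz; rewrite ltnNge -ltnS z1.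
(* The entry [b] is the 1 of [p2], so the shift is [b - 1]. *)
pose k := b.-1; have kE : b = k.+1 by rewrite /k prednK // ltnW.
have k_A1 : map (addn k) (map (subn^~ k) A1) = A1.
  rewrite -map_comp -[RHS]map_id; apply/eq_in_map => x.
  by rewrite mem_filter kE /= => /andP[/ltnW/ltnW kx _]; rewrite subnKC.
have k_C : map (addn k) (map (subn^~ k) C) = C.
  rewrite -map_comp -[RHS]map_id; apply/eq_in_map => x /Cb.
  by rewrite kE /= => /ltnW/ltnW kx; rewrite subnKC.
have k_A2 : map (addn 1) (map predn A2) = A2.
  by rewrite -map_comp -[RHS]map_id; apply/eq_in_map => x; rewrite mem2 => /andP[]; case: x.
set p1 := map predn A2 in k_A2.
have p1E : perm_eq p1 (iota 1 (b - 2)).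
  apply: (@perm_map_inj _ _ (addn 1)); first exact: addnI.
  rewrite k_A2 -iotaDl; apply: uniq_perm; rewrite ?iota_uniq //.
    by rewrite filter_uniq.
  by move=> x; rewrite mem2 mem_iota; clear -b2; lia.
have sp1 : size p1 = b - 2 by rewrite (perm_size p1E) size_iota.
exists p1, (map (subn^~ k) A1), (map (subn^~ k) C); split.
- by rewrite sp1 subn_gt0.
- by rewrite sp1.
- have -> : w = A1 ++ A2 ++ 1 :: b :: C by rewrite /w {1}Asplit catA.
  have ek : (size p1).+1 = k by rewrite sp1 kE; move: b2; rewrite kE; clear; lia.
  rewrite /arch_perm ek k_A1 k_A2 /= k_C.
  by rewrite addn1 -kE.
Qed.

(** Strong induction on the length, according to whether 1 is the last entry. In both cases the
    pieces are shorter and again avoid the patterns. *)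
Lemma good_tree w : good w -> 0 < size w -> exists t, perm_of t = w.
Proof.
have [m] := ubnP (size w); elim: m => // m IH in w *.
move=> sw gw w0.
have : 1 \in w by case: gw => pw _ _; rewrite (perm_mem pw) mem_iota; lia.
move=> /path.splitPr w1; case: w1 gw sw w0 => A [|b C] gw sw _.
- have Apos x : x \in A -> 0 < x.
    have [pw _ _] := gw; move=> xA; have : x \in A ++ [:: 1] by rewrite mem_cat xA.
    by rewrite (perm_mem pw) mem_iota; lia.
  have eA : A = map (addn 1) (map predn A).
    by rewrite -map_comp -[LHS]map_id; apply/eq_in_map => x /Apos /=; lia.
  (* The one-letter word is set apart, since removing its 1 leaves the empty word, which belongs to
     no tree. *)
  case: (posnP (size A)) => [/size0nil ->|A0]; first by exists Leaf.
  rewrite eA in gw *; have /good_flat gA := gw.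
  have [||t et] := IH _ _ gA; rewrite ?size_map //.
    by move: sw; rewrite size_cat /=; lia.
  by exists (FlatNode t); rewrite -et.
- have [p1 [u [v [p0 pp e]]]] := good_split_arch gw.
  rewrite e in gw sw *; rewrite size_arch_perm in sw.
  have [g1 g2] := (good_arch u v p0 pp).1 gw.
  have [||t1 et1] := IH _ _ g1 => //; first by lia.
  have [||t2 et2] := IH _ _ g2; first by lia.
    by rewrite /around_one size_cat /=; lia.
  exists (ArchNode t1 t2); rewrite perm_of_arch et1.
  by rewrite (around_one_inj (good_uniq (good_perm_of t2)) et2).
Qed.

Theorem theorem4 (n : nat) : set_bij (motzkin_paths n) (S_avoiding n.+1) psi.
Proof.
split.
- move=> M [sM /motzkin_word[t eM]]; subst M; rewrite psi_word; apply/S_avoidingP.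
  by split; [rewrite size_perm_of sM | exact: good_perm_of].
- move=> M N; rewrite !inE => -[_ /motzkin_word[t ->]] [_ /motzkin_word[t' ->]].
  rewrite !psi_word => /(around_one_inj (good_uniq (good_perm_of t))).
  by move=> /sides_inj ->.
- move=> w /S_avoidingP[sw gw]; have [|t et] := good_tree gw; first by rewrite sw.
  exists (word t); last by rewrite psi_word.
  split; last exact: word_motzkin.
  by have := size_perm_of t; rewrite et sw => -[].
Qed.
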